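(* Let $n\geq 4$. Then the matrix $\mathfrak{I}_n=\big(\mathtt{inv_X}(\pi\tau^{-1})\big)_{\pi,\tau\in\mathcal{S}_n}$ is diagonalizable and $$Sp(\mathfrak{I}_n)=\Big\{\tfrac{n!}{2}\sum_{1\le i<j\le n}X_{i,j},\ -(n-2)!\sum_{1\le i<j\le n}(j-i)X_{i,j},\ -(n-3)!\sum_{1\le i<j\le n}\big(n-2(j-i)\big)X_{i,j},\ 0\Big\},$$ with multiplicities $V_{\mathfrak{I}_n}\big(\tfrac{n!}{2}\sum_{i<j}X_{i,j}\big)=1$, $V_{\mathfrak{I}_n}\big(-(n-2)!\sum_{i<j}(j-i)X_{i,j}\big)=n-1$, $V_{\mathfrak{I}_n}\big(-(n-3)!\sum_{i<j}(n-2(j-i))X_{i,j}\big)=\binom{n-1}{2}$, and $V_{\mathfrak{I}_n}(0)=n!-\binom{n}{2}-1$.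
   Context: $\mathcal{S}_n$ is the symmetric group on $[n]=\{1,\dots,n\}$. For $\sigma\in\mathcal{S}_n$, $\mathtt{INV}(\sigma)=\{(i,j): i<j,\ \sigma(i)>\sigma(j)\}$ and $\mathtt{inv_X}(\sigma)=\sum_{(i,j)\in\mathtt{INV}(\sigma)}X_{i,j}\in\mathbb{R}[X_{i,j}: 1\le i<j\le n]$. The matrix $\mathfrak{I}_n$ has rows and columns indexed by $\mathcal{S}_n$ (in a fixed linear order, the same for rows and columns). $Sp(A)$ denotes the spectrum of a square matrix $A$ and $V_A(a)$ the multiplicity of the eigenvalue $a$. *)

(* Defs.v *)
From HB Require Import structures.
From mathcomp Require Import all_boot all_order all_algebra all_fingroup.
From mathcomp Require Import reals.
From mathcomp Require Import mpoly.

Set Implicit Arguments.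
Unset Strict Implicit.
Unset Printing Implicit Defensive.

Import GRing.Theory.

Local Open Scope ring_scope.

(* [n] is represented by 'I_n = {0, ..., n-1}: indices are shifted by one, which
   affects neither the order i < j nor the differences j - i. *)
Definition ipair (n : nat) := {p : 'I_n * 'I_n | (p.1 < p.2)%N}.

Definition lo n (p : ipair n) : 'I_n := (val p).1.
Definition hi n (p : ipair n) : 'I_n := (val p).2.

(* R[X_{i,j} : i < j], with one variable per element of ipair n. *)
Definition pairpoly (R : realType) (n : nat) := {mpoly R[#|{: ipair n}|]}.

Definition Xvar (R : realType) n (p : ipair n) : pairpoly R n :=
  'X_(enum_rank p).

Definition INV n (s : {perm 'I_n}) : {set ipair n} :=
  [set p | (s (hi p) < s (lo p))%N].

Definition invX (R : realType) n (s : {perm 'I_n}) : pairpoly R n :=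
  \sum_(p in INV s) Xvar R p.

(* e enumerates S_n and thus fixes the order of both rows and columns.
   The product of permutations in MathComp is (s * t) x = t (s x), so the
   composition pi o tau^-1 is written tau^-1 * pi. *)
Definition inversion_mx (R : realType) n (e : 'I_(n`!) -> {perm 'I_n}) :
    'M[pairpoly R n]_(n`!) :=
  \matrix_(k, l) invX R ((e l)^-1 * e k)%g.

(* Eigenvalues and diagonalization of a matrix with entries in an integral
   domain D are taken over the field of fractions of D. *)
Definition fracmx (D : idomainType) m (A : 'M[D]_m) : 'M[{fraction D}]_m :=
  map_mx (@tofrac D) A.

Definition eigen_mult (F : fieldType) m (A : 'M[F]_m) (a : F) : nat :=
  mup a (char_poly A).

(* Main.v *)
(* Since [g i > g j] = (1 + sgn (g i - g j)) / 2 for i <> j, the matrix is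
   (S/2) J + (1/2) U V, where S is the sum of the variables, J is the all-ones
   matrix, U x p = sgn(x(lo p), x(hi p)) and V p y = Z(y(lo p), y(hi p)), with Z
   the antisymmetric extension of X; p ranges over the pairs i < j.
   All sums along permutations in U and V vanish, so the two summands annihilate
   each other. The first one yields the eigenvalue (n!/2) S, and the nonzero
   eigenvalues of the second one are those of V U / 2, a matrix of size C(n,2).
   Averaging over S_n gives V U / 2 = a3 I + t D^T D, where D is the incidence
   matrix of the complete graph K_n. As D D^T = n I - J and J D = 0, the rows of D
   (rank n-1) are eigenvectors for a2 = a3 + n t, and the kernel of D^T (dimension
   C(n-1,2)) is an eigenspace for a3. The kernel of the whole matrix has dimension
   at least n! - C(n,2) - 1, and these lower bounds add up to n!. *)
Require Import Defs.
From mathcomp Require Import all_boot all_order all_algebra all_fingroup.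
From mathcomp Require Import reals.
From mathcomp Require Import mpoly.
From mathcomp Require Import ring lra zify.

Set Implicit Arguments.
Unset Strict Implicit.
Unset Printing Implicit Defensive.

Import GRing.Theory Num.Theory.

Local Open Scope ring_scope.

(** * Eigenspaces and multiplicities *)

Lemma sum_rank_eigenspace_le (F : fieldType) N (A : 'M[F]_N) (I : finType)
    (a : I -> F) :
  injective a -> (\sum_i \rank (eigenspace A (a i)) <= N)%N.
Proof.
move=> a_inj; have /mxdirectP/= <- : mxdirect (\sum_i eigenspace A (a i)).
  by apply: mxdirect_sum_eigenspace => i j _ _; apply: a_inj.
exact: rank_leq_row.
Qed.

(** An eigenvector for [x] has zero coordinates wherever the diagonal entry differs from [x], so the
    eigenspace lies in the span of the remaining unit vectors. *)
Lemma rank_eigenspace_diag_le (F : fieldType) N (d : 'rV[F]_N) (x : F) :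
  (\rank (eigenspace (diag_mx d) x) <= #|[pred j | d 0%R j == x]|)%N.
Proof.
set E := eigenspace _ _.
have sub : (E <= \sum_(j | d 0%R j == x) <<delta_mx (0 : 'I_1) j>>)%MS.
  apply/row_subP => i.
  have /eigenspaceP/rowP Ei : (row i E <= E)%MS by apply: row_sub.
  rewrite [row i E]row_sum_delta; apply: summx_sub => j _.
  case: (eqVneq (d 0 j) x) => [dj | ndj].
    by apply: scalemx_sub; rewrite (sumsmx_sup j) ?genmxE //; apply/eqP.
  move: (Ei j); rewrite mul_mx_diag !mxE => /eqP.
  rewrite [x * _]mulrC -subr_eq0 -mulrBr mulf_eq0 subr_eq0 (negPf ndj) orbF.
  by move=> /eqP->; rewrite scale0r sub0mx.
apply: leq_trans (mxrankS sub) _; rewrite -sum1_card.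
apply: leq_trans (mxrank_sum_leqif _) _; rewrite /=.
by apply: leq_sum => j _; rewrite genmxE mxrank_delta.
Qed.

Section Similarity.
Variables (F : fieldType) (N : nat) (A P B : 'M[F]_N).
Hypotheses (Pu : P \in unitmx) (PA : P *m A = B *m P).

Lemma char_poly_similar : char_poly A = char_poly B.
Proof.
have polyP_unit : map_mx polyC P \in unitmx by rewrite map_unitmx.
have -> : A = invmx P *m B *m P by rewrite -mulmxA -PA mulKmx.
rewrite /char_poly /char_poly_mx !map_mxM map_invmx.
set Q := map_mx polyC P.
have -> : 'X%:M - invmx Q *m map_mx polyC B *m Q
          = invmx Q *m ('X%:M - map_mx polyC B) *m Q.
  by rewrite mulmxBr mulmxBl scalar_mxC mulmxKV.
by rewrite !det_mulmx mulrAC -det_mulmx mulVmx // det1 mul1r.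
Qed.

Lemma rank_eigenspace_similar x :
  \rank (eigenspace A x) = \rank (eigenspace B x).
Proof.
rewrite /eigenspace !mxrank_ker; congr (_ - _)%N.
have -> : A - x%:M = invmx P *m (B - x%:M) *m P.
  by rewrite mulmxBr mulmxBl -[_ *m B *m P]mulmxA -PA mulKmx // scalar_mxC mulmxKV.
by rewrite mxrankMfree ?row_free_unit // eqmxMfull ?row_full_unit ?unitmx_inv //.
Qed.

End Similarity.

(* Geometric multiplicities adding up to the dimension force the eigenspaces to
   span, and then geometric and algebraic multiplicities agree. *)
Lemma spectrum_of_rank_eigenspace (F : fieldType) N (A : 'M[F]_N) (I : finType)
    (a : I -> F) (m : I -> nat) :
    injective a -> (forall i, m i <= \rank (eigenspace A (a i)))%N ->
    (\sum_i m i = N)%N ->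
  [/\ diagonalizable A, (forall x, eigenvalue A x -> exists i, x = a i)
    & forall i, mup (a i) (char_poly A) = m i].
Proof.
move=> a_inj le_m sum_m.
have sum_r : (\sum_i \rank (eigenspace A (a i)) = N)%N.
  apply/eqP; rewrite eqn_leq sum_rank_eigenspace_le //= -{1}sum_m.
  exact: leq_sum.
have dA : diagonalizable A.
  apply/diagonalizablePeigen; exists [seq a i | i <- enum I].
    by rewrite map_inj_uniq ?enum_uniq.
  rewrite big_map big_enum /=; apply/eqmxP.
  rewrite submx1 sub1mx /row_full.
  have /mxdirectP/= -> : mxdirect (\sum_i eigenspace A (a i)).
    by apply: mxdirect_sum_eigenspace => i j _ _; apply: a_inj.
  by rewrite sum_r.
split=> // [x x_eig | ].
  case: (pickP (fun i => x == a i)) => [i /eqP | xa]; first by exists i.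
  (* An eigenvalue [x] outside the family is adjoined as the value at [None]. The other ranks
     already fill the dimension, so its eigenspace would be zero. *)
  pose b (o : option I) := oapp a x o.
  have b_inj : injective b.
    case=> [i|] [j|] //=; first by move=> /a_inj->.
      by move/eqP; rewrite eq_sym xa.
    by move/eqP; rewrite xa.
  have := sum_rank_eigenspace_le A b_inj.
  rewrite (bigD1 None) //= (reindex_omap Some id) /=; last by case.
  under eq_bigl do rewrite eqxx.
  rewrite sum_r -[leqRHS]add0n leq_add2r leqn0 mxrank_eq0.
  by move/eqP => E0; case/negP: x_eig; apply/eqP.
have [P Pu /similar_diagPex[d /(similarP Pu) PA]] := dA.
(* After diagonalization, [c x] is the algebraic multiplicity of [x] and bounds the geometric
   one. *)
pose c x := #|[pred j | d 0%R j == x]|.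
have mupE x : mup x (char_poly A) = c x.
  rewrite (char_poly_similar Pu PA) char_poly_trig ?diag_mx_is_trig //.
  under eq_bigr do rewrite mxE eqxx mulr1n.
  rewrite -(big_image _ _ (d 0) predT (fun y => 'X - y%:P)).
  rewrite mu_prod_XsubC count_map /c cardE size_filter enumT.
  exact: eq_count.
have le_mc i : (m i <= c (a i))%N.
  rewrite (leq_trans (le_m i)) // (rank_eigenspace_similar Pu PA).
  exact: rank_eigenspace_diag_le.
have sum_c : (\sum_i c (a i) <= N)%N.
  under eq_bigr do rewrite /c -sum1_card.
  rewrite (exchange_big_dep xpredT) //= -[leqRHS]card_ord -sum1_card.
  apply: leq_sum => j _; rewrite sum1_card.
  by apply/card_le1_eqP => i1 i2 /eqP-> /eqP/a_inj.
move=> i; rewrite mupE; apply/eqP; rewrite eq_sym.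
(* Termwise [m i <= c (a i)], while the sum of the [c (a i)] is at most that of the [m i]; hence
   equality in every term. *)
have /leqifP := leqif_sum (fun i (_ : true) => leqif_eq (le_mc i)).
by rewrite sum_m; case: forallP => [/(_ i) // | _]; rewrite ltnNge sum_c.
Qed.

(** * Averages over permutations *)

(** The left factor acts first and sends [a] to [a']. The second transposition corrects the image of
    [b] and fixes [a'], which is neither that image nor [b']. *)
Lemma perm_2transitive (T : finType) (a b a' b' : T) :
  a != b -> a' != b' -> exists g : {perm T}, g a = a' /\ g b = b'.
Proof.
move=> ab ab'; exists (tperm a a' * tperm (tperm a a' b) b')%g.
have b1 : tperm a a' b != a'.
  by rewrite -{2}(tpermL a a') (inj_eq perm_inj) eq_sym.
by rewrite !permM tpermL tpermL tpermD // eq_sym.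
Qed.

Section PermutationAverages.
Variables (F : fieldType) (n : nat).
Implicit Types (G : 'I_n -> 'I_n -> F) (H : 'I_n -> 'I_n -> 'I_n -> F).

Lemma sum_perm_lmul (g : {perm 'I_n}) (f : {perm 'I_n} -> F) :
  \sum_t f (g * t)%g = \sum_t f t.
Proof. by rewrite [RHS](reindex_inj (mulgI g)). Qed.

Hypothesis F0 : [pchar F] =i pred0.

Lemma natr_eq0 k : (k%:R == 0 :> F) = (k == 0%N).
Proof. by move/pcharf0P: F0 => ->. Qed.

(* By 2-transitivity the left-hand side does not depend on (a, b), so it can be
   averaged over all pairs. *)
Lemma sum_perm_pair G (a b : 'I_n) : a != b -> (forall i, G i i = 0) ->
  \sum_(t : {perm 'I_n}) G (t a) (t b) = (n - 2)`!%:R * \sum_i \sum_j G i j.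
Proof.
move=> ab G0; set N := \sum_(t : {perm 'I_n}) G (t a) (t b).
have n2 : (1 < n)%N.
  by move: ab; rewrite -val_eqE /=; case: a b {N} => [a ?] [b ?] /=; lia.
have total : \sum_i \sum_j \sum_(t : {perm 'I_n}) G (t i) (t j)
    = n`!%:R * \sum_i \sum_j G i j.
  under eq_bigr do rewrite exchange_big /=.
  rewrite exchange_big /= -card_Sn mulr_natl -sumr_const.
  apply: eq_big => [t | t _]; first by rewrite inE.
  rewrite [RHS](reindex_inj (@perm_inj _ t)) /=; apply: eq_bigr => i _.
  by rewrite [RHS](reindex_inj (@perm_inj _ t)).
have const i j : j != i -> \sum_(t : {perm 'I_n}) G (t i) (t j) = N.
  rewrite eq_sym => ij; have [g [ga gb]] := perm_2transitive ab ij.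
  rewrite -ga -gb /N -(sum_perm_lmul g (fun t => G (t a) (t b))).
  by apply: eq_bigr => t _; rewrite !permM.
have : (n * (n - 1))%:R * N = n`!%:R * \sum_i \sum_j G i j.
  rewrite -total natrM -mulrA [RHS](eq_bigr (fun => (n - 1)%:R * N)).
    by rewrite sumr_const card_ord mulr_natl.
  move=> i _; rewrite (bigD1 i) //= [X in X + _]big1 ?add0r //.
  rewrite (eq_bigr _ (const i)) sumr_const mulr_natl.
  by congr (_ *+ _); rewrite cardC1 card_ord subn1.
have nn : (n * (n - 1))%:R != 0 :> F by rewrite natr_eq0; lia.
have -> : (n`! = n * (n - 1) * (n - 2)`!)%N.
  by case: (n) n2 => [|[|m]] // _; rewrite !factS subn1 subn2 mulnA.
by rewrite (natrM _ (n * (n - 1))) -mulrA; apply: mulfI.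
Qed.

End PermutationAverages.

(** * Symmetric and antisymmetric sums over pairs *)

Section PairFunctions.
Variables (F : fieldType) (n : nat) (X : ipair n -> F).

Definition upper (i j : 'I_n) : F := oapp X 0 (insub (i, j)).
(** The antisymmetric extension Z of X from the overview. *)
Definition skew (i j : 'I_n) : F := upper i j - upper j i.
Definition sgn (i j : 'I_n) : F := (j < i)%:R - (i < j)%:R.

Lemma upper_ge (i j : 'I_n) : (j <= i)%N -> upper i j = 0.
Proof. by move=> ji; rewrite /upper insubN //= -leqNgt. Qed.

Lemma upper_ipair (p : ipair n) : upper (lo p) (hi p) = X p.
Proof. by rewrite /upper -surjective_pairing valK. Qed.

Lemma skewC i j : skew j i = - skew i j.
Proof. by rewrite opprB. Qed.

Lemma sgnC i j : sgn j i = - sgn i j.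
Proof. by rewrite opprB. Qed.

Lemma skewii i : skew i i = 0. Proof. exact: subrr. Qed.
Lemma sgnii i : sgn i i = 0. Proof. exact: subrr. Qed.

Lemma sum_upper (G : 'I_n -> 'I_n -> F) :
  \sum_i \sum_j upper i j * G i j = \sum_p X p * G (lo p) (hi p).
Proof.
rewrite pair_bigA /= (bigID (fun q : 'I_n * 'I_n => (q.1 < q.2)%N)) /=.
rewrite [X in _ + X]big1 ?addr0 => [|q]; last first.
  by rewrite -leqNgt => /upper_ge->; rewrite mul0r.
rewrite (reindex_omap (val : ipair n -> _) insub) /=; last first.
  by move=> q q12; rewrite insubT.
apply: eq_big => [p | p _]; first by rewrite valK eqxx (valP p).
by rewrite -(upper_ipair p).
Qed.

Lemma sum_skew (G : 'I_n -> 'I_n -> F) :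
  \sum_i \sum_j skew i j * G i j
  = \sum_p X p * (G (lo p) (hi p) - G (hi p) (lo p)).
Proof.
rewrite -(sum_upper (fun i j => G i j - G j i)).
have -> : \sum_i \sum_j skew i j * G i j
    = \sum_i \sum_j upper i j * G i j - \sum_j \sum_i upper j i * G i j.
  rewrite [X in _ - X]exchange_big /= -sumrB; apply: eq_bigr => i _.
  by rewrite -sumrB; apply: eq_bigr => j _; rewrite mulrBl.
rewrite -sumrB; apply: eq_bigr => i _.
by rewrite -sumrB; apply: eq_bigr => j _; rewrite mulrBr.
Qed.

Lemma sum_ltn_ord k : (k <= n)%N -> \sum_(j < n) (j < k)%:R = k%:R :> F.
Proof.
move=> kn; rewrite -natr_sum; congr (_%:R).
by rewrite -big_mkcond -(big_ord_widen _ (fun => 1%N)) // sum1_card card_ord.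
Qed.

(** Counting from 0, the index [i] exceeds [i] indices and is exceeded by [n - i.+1] of them. *)
Lemma sum_sgn i : \sum_k sgn i k = i%:R + i.+1%:R - n%:R.
Proof.
have -> : \sum_k sgn i k = \sum_(k < n) ((k < i)%:R + (k < i.+1)%:R - 1).
  apply: eq_bigr => k _; rewrite /sgn ltnS -addrA; congr (_ + _).
  by rewrite (leqNgt k); case: (i < k)%N; rewrite /= ?mulr1n ?mulr0n; ring.
rewrite !big_split /= sum_ltn_ord ?(ltnW (ltn_ord i)) // sum_ltn_ord //.
by rewrite sumrN sumr_const card_ord.
Qed.

End PairFunctions.

(** * The entries of V U as sums over permutations *)

Section PairCorrelation.
Variables (F : fieldType) (n : nat) (X : ipair n -> F).
Hypotheses (F0 : [pchar F] =i pred0) (n4 : (4 <= n)%N).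

Let S := \sum_p X p.
Let Sd := \sum_p (hi p - lo p)%:R * X p.

(** The entry of V U at the pairs (c, d) and (a, b). Being invariant under simultaneous relabelling,
    it depends only on how the two pairs overlap. *)
Definition corr (c d a b : 'I_n) : F :=
  \sum_(t : {perm 'I_n}) skew X (t c) (t d) * sgn F (t a) (t b).

Lemma corrCl c d a b : corr d c a b = - corr c d a b.
Proof. by rewrite -sumrN; apply: eq_bigr => t _; rewrite skewC mulNr. Qed.

Lemma corrCr c d a b : corr c d b a = - corr c d a b.
Proof. by rewrite -sumrN; apply: eq_bigr => t _; rewrite sgnC mulrN. Qed.

Lemma corr_perm (g : {perm 'I_n}) c d a b :
  corr (g c) (g d) (g a) (g b) = corr c d a b.
Proof.
rewrite /corr -(sum_perm_lmul g (fun t => skew X (t c) (t d) * sgn F (t a) (t b))).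
by apply: eq_bigr => t _; rewrite !permM.
Qed.

(** Swapping [c] and [d] fixes [a] and [b] but reverses the sign, so the value equals its own
    negative. *)
Lemma corr_disjoint c d a b :
  a != c -> a != d -> b != c -> b != d -> corr c d a b = 0.
Proof.
move=> ac ad bc bd; have := corr_perm (tperm c d) c d a b.
rewrite tpermL tpermR !tpermD 1?eq_sym // corrCl => /eqP.
by rewrite eq_sym -addr_eq0 -mulr2n -mulr_natl mulf_eq0 natr_eq0 //= => /eqP.
Qed.

(** The sum reduces to one over pairs p, each contributing -2 X p because [sgn] is -1 on an
    increasing pair. *)
Lemma corr_same a b : a != b -> corr a b a b = - 2%:R * (n - 2)`!%:R * S.
Proof.
move=> ab; rewrite /corr.
rewrite (sum_perm_pair F0 (G := fun i j => skew X i j * sgn F i j)) //; last first.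
  by move=> i; rewrite sgnii mulr0.
rewrite sum_skew [- _ * _]mulrC -!mulrA; congr (_ * _).
rewrite mulr_sumr; apply: eq_bigr => p _.
have pl : (lo p < hi p)%N := valP p.
by rewrite /sgn pl ltnNge ltnW //=; ring.
Qed.

(* The value does not depend on c, and summing it over c leaves a sum over pairs
   instead of triples. *)
Lemma corr_shared a b c : a != b -> a != c -> b != c ->
  corr a b a c = 2%:R * (n - 3)`!%:R * (S - Sd).
Proof.
move=> ab ac bc.
have const c' : c' != a -> c' != b -> corr a b a c' = corr a b a c.
  move=> c'a c'b; rewrite -(corr_perm (tperm c c')) tpermR.
  by rewrite !tpermD // eq_sym.
have total : \sum_c' corr a b a c' = - 2%:R * (n - 2)`!%:R * Sd.
  rewrite exchange_big /=.
  under eq_bigr => t _.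
    rewrite -mulr_sumr -(reindex_inj (@perm_inj _ t) (P := predT)).
    over.
  (* Reindexing [c'] by [t] makes the inner sum a row sum of [sgn], which depends on [t a] alone;
     the pair formula then applies to [G]. *)
  pose G i j := skew X i j * \sum_k sgn F i k.
  rewrite /= (sum_perm_pair F0 (G := G)) //; last first.
    by move=> i; rewrite /G skewii mul0r.
  rewrite sum_skew [- _ * _]mulrC -!mulrA; congr (_ * _).
  rewrite mulr_sumr; apply: eq_bigr => p _.
  have pl : (lo p <= hi p)%N := ltnW (valP p).
  by rewrite !sum_sgn natrB // -!natr1; ring.
have : (n - 2)%:R * corr a b a c = (n - 2)%:R * (2%:R * (n - 3)`!%:R * (S - Sd)).
  have fact3 : ((n - 2)`! = (n - 2) * (n - 3)`!)%N.
    by rewrite (_ : n - 2 = (n - 3).+1)%N //; lia.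
  transitivity (\sum_c' corr a b a c' - corr a b a b); last first.
    by rewrite total corr_same // fact3 natrM; ring.
  (* The term at [a] vanishes, the term at [b] is subtracted, and the other n - 2 terms are
     equal. *)
  rewrite (bigD1 a) //= (bigD1 b) 1?eq_sym //=.
  rewrite (_ : corr a b a a = 0) ?add0r; last first.
    by apply: big1 => t _; rewrite sgnii mulr0.
  rewrite addrC addrK (eq_bigr (fun => corr a b a c)); last first.
    by move=> c' /andP[]; apply: const.
  rewrite sumr_const mulr_natl; congr (_ *+ _).
  have := cardC (pred2 a b); rewrite card2 ab card_ord => /esym/(congr1 (subn^~ 2))/=->.
  by rewrite addKn; apply: eq_card => x; rewrite !inE negb_or.
by apply: mulfI; rewrite natr_eq0 //; lia.
Qed.

(** The coefficient t of the overview; [eig3] below is a3. *)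
Definition corr_coef := (n - 3)`!%:R * (S - Sd).
Definition eig3 := - (n - 3)`!%:R * (n%:R * S - 2%:R * Sd).

(** The factor of [corr_coef] is the inner product of e_c - e_d and e_a - e_b, an entry of D^T D up
    to orientation. Antisymmetry reduces every overlap to the same, shared or disjoint case. *)
Lemma corrE c d a b : c != d -> a != b -> corr c d a b =
  2%:R * (eig3 * (((c == a) && (d == b))%:R - ((c == b) && (d == a))%:R)
  + corr_coef * ((c == a)%:R - (c == b)%:R - (d == a)%:R + (d == b)%:R)).
Proof.
have same x y : x != y ->
    corr x y x y = 2%:R * (eig3 + 2%:R * corr_coef).
  move=> xy; rewrite corr_same // /eig3 /corr_coef.
  have -> : ((n - 2)`! = (n - 2) * (n - 3)`!)%N.
    by rewrite (_ : n - 2 = (n - 3).+1)%N //; lia.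
  by rewrite natrM natrB ?(leq_trans _ n4) //; ring.
have shared x y z : x != y -> x != z -> y != z ->
    corr x y x z = 2%:R * corr_coef.
  by move=> xy xz yz; rewrite corr_shared // /corr_coef; ring.
move=> cd ab.
have ba : b != a by rewrite eq_sym.
case: (eqVneq c a) cd => [->|ca] cd.
  rewrite (negPf ab) [d == a]eq_sym (negPf cd) /=.
  case: (eqVneq d b) cd => [-> _|db cd]; first by rewrite same //=; ring.
  by rewrite shared //=; ring.
case: (eqVneq c b) cd => [->|cb] cd; rewrite [d == b]eq_sym.
  rewrite (negPf cd) corrCr.
  case: (eqVneq d a) cd => [-> _|da cd]; first by rewrite same //=; ring.
  by rewrite shared //=; ring.
have bc : b != c by rewrite eq_sym.
case: (eqVneq d a) cd => [-> _|da cd].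
  by rewrite corrCl shared 1?[a == c]eq_sym // (negPf ba) /=; ring.
case: (eqVneq b d) cd => [<- _|bd cd] /=.
  by rewrite corrCl corrCr opprK shared //=; ring.
by rewrite corr_disjoint 1?[a == _]eq_sym //=; ring.
Qed.

End PairCorrelation.

(** * The incidence matrix of the complete graph *)

Lemma rank_const_mx_le1 (F : fieldType) m n (c : F) :
  (\rank (const_mx c : 'M_(m, n)) <= 1)%N.
Proof.
rewrite (_ : const_mx c = (const_mx c : 'cV_m) *m (const_mx 1 : 'rV_n)).
  exact: leq_trans (mxrankM_maxl _ _) (rank_leq_col _).
by apply/matrixP => i j; rewrite !mxE big_ord1 !mxE mulr1.
Qed.

Lemma rank_const_mx1_gt0 (F : fieldType) n :
  (0 < n)%N -> (0 < \rank (const_mx 1%R : 'rV[F]_n))%N.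
Proof.
move=> n_gt0; rewrite lt0n mxrank_eq0; apply/eqP => /rowP/(_ (Ordinal n_gt0)).
by rewrite !mxE => /eqP; rewrite oner_eq0.
Qed.

Lemma card_ipair n : #|{: ipair n}| = 'C(n, 2).
Proof.
rewrite card_sig -sum1_card -bin2_sum big_mkord.
rewrite -(pair_big_dep xpredT (fun i j : 'I_n => (i < j)%N) (fun _ _ => 1%N)) /=.
rewrite (exchange_big_dep xpredT) //=; apply: eq_bigr => j _.
by rewrite -(big_ord_widen _ (fun => 1%N)) ?(ltnW (ltn_ord j)) // sum1_card card_ord.
Qed.

(** Makes the multiplicity of the eigenvalue 0 positive and its truncated subtractions exact. *)
Lemma bin2S_lt_fact n : (4 <= n)%N -> ('C(n, 2).+1 < n`!)%N.
Proof.
case: n => [|[|n]] // n2; rewrite bin2 /= !factS mulnA.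
have : (1 < n`!)%N := leq_trans (n2 : 1 < n)%N (fact_geq n).
have := half_leq (leqnn (n.+2 * n.+1)); nia.
Qed.

Section IncidenceMatrix.
Variables (F : fieldType) (n : nat).
Hypothesis F0 : [pchar F] =i pred0.

Lemma upper_const (c : F) (i j : 'I_n) :
  (i < j)%N -> upper (fun=> c) i j = c.
Proof. by move=> ij; exact: (upper_ipair (fun=> c) (exist _ (i, j) ij)). Qed.

Lemma sum_ipair_sym (G : 'I_n -> 'I_n -> F) :
    (forall i j, G j i = G i j) -> (forall i, G i i = 0) ->
  \sum_i \sum_j G i j = 2%:R * \sum_p G (lo p) (hi p).
Proof.
move=> Gsym G0; pose u := upper (fun _ : ipair n => 1 : F).
have -> : \sum_(p : ipair n) G (lo p) (hi p) = \sum_i \sum_j u i j * G i j.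
  by rewrite sum_upper; apply: eq_bigr => p _; rewrite mul1r.
(* Off the diagonal exactly one of [u i j] and [u j i] is 1; on the diagonal [G] vanishes. *)
have -> : \sum_i \sum_j G i j = \sum_i \sum_j (u i j + u j i) * G i j.
  apply: eq_bigr => i _; apply: eq_bigr => j _; rewrite /u.
  have [ij|ji|/val_inj->] := ltngtP i j; last by rewrite !G0 mulr0.
    by rewrite upper_const // (upper_ge _ (ltnW ij)) addr0 mul1r.
  by rewrite (upper_ge _ (ltnW ji)) upper_const // add0r mul1r.
rewrite mulr_natl mulr2n [X in _ = _ + X]exchange_big /= -big_split /=.
apply: eq_bigr => i _; rewrite -big_split /=; apply: eq_bigr => j _.
by rewrite mulrDl [in u j i * _]Gsym.
Qed.

Lemma sum_delta (x : 'I_n) : \sum_i (x == i)%:R = 1 :> F.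
Proof.
rewrite (bigD1 x) //= eqxx big1 ?addr0 // => i.
by rewrite eq_sym => /negPf->.
Qed.

Lemma sum_delta2 (x y : 'I_n) :
  \sum_i (x == i)%:R * (y == i)%:R = (x == y)%:R :> F.
Proof.
rewrite (bigD1 x) //= eqxx mul1r big1 ?addr0 1?eq_sym // => i.
by rewrite eq_sym => /negPf->; rewrite mul0r.
Qed.

Definition incidence_mx : 'M[F]_(n, #|{: ipair n}|) :=
  \matrix_(v, p) ((lo (enum_val p) == v)%:R - (hi (enum_val p) == v)%:R).

Local Notation D := incidence_mx.

Lemma const_mulmx_incidence m : const_mx 1 *m D = 0 :> 'M_(m, _).
Proof.
apply/matrixP => i p; rewrite !mxE.
under eq_bigr do rewrite !mxE mul1r.
rewrite sumrB; apply/eqP; rewrite subr_eq0; apply/eqP.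
by rewrite !sum_delta.
Qed.

(** This is the Laplacian of K_n. The sum over edges is doubled to one over all ordered pairs, where
    the expanded product factors into sums of deltas. *)
Lemma incidence_mulmx_tr : D *m D^T = n%:R%:M - const_mx 1.
Proof.
apply/matrixP => v w; rewrite !mxE.
pose G i j : F := ((i == v)%:R - (j == v)%:R) * ((i == w)%:R - (j == w)%:R).
have -> : \sum_p D v p * D^T p w = \sum_(p : ipair n) G (lo p) (hi p).
  rewrite [RHS](reindex_onto enum_val enum_rank) => [|p _]; last exact: enum_rankK.
  by apply: eq_big => [p | p _]; rewrite ?enum_valK ?eqxx // !mxE.
apply: (mulfI (_ : 2%:R != 0 :> F)); first by rewrite natr_eq0.
rewrite -sum_ipair_sym => [|i j|i]; rewrite /G; [|ring|ring].
transitivity (\sum_i (n%:R * ((v == i)%:R * (w == i)%:R) - (v == i)%:R - (w == i)%:R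
    + (v == w)%:R) : F).
  apply: eq_bigr => i _.
  under eq_bigr => j _.
    rewrite ![_ == v]eq_sym ![_ == w]eq_sym.
    rewrite (_ : _ * _ = (v == i)%:R * (w == i)%:R - (v == i)%:R * (w == j)%:R
      - (w == i)%:R * (v == j)%:R + (v == j)%:R * (w == j)%:R); last by ring.
    over.
  rewrite big_split !sumrB /= -!mulr_sumr !sum_delta !mulr1.
  by rewrite sumr_const card_ord sum_delta2 -[_ *+ n]mulr_natl; ring.
rewrite big_split !sumrB /= -!mulr_sumr !sum_delta sum_delta2.
by rewrite sumr_const card_ord -[_ *+ n]mulr_natl -(mulr_natr _ (v == w)); ring.
Qed.

(** The all-ones row in the left kernel gives the upper bound. For the lower one, n I = D D^T + J
    has rank n and J has rank at most 1. *)
Lemma rank_incidence : (0 < n)%N -> \rank D = (n - 1)%N.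
Proof.
move=> n_gt0; apply/eqP; rewrite eqn_leq; apply/andP; split.
  have : (\rank (const_mx 1%R : 'rV[F]_n) <= n - \rank D)%N.
    by rewrite -mxrank_ker; apply/mxrankS/sub_kermxP/const_mulmx_incidence.
  by have := rank_const_mx1_gt0 F n_gt0; lia.
rewrite leq_subLR.
have rk_n : \rank (n%:R%:M : 'M[F]_n) = n.
  by rewrite mxrank_unit // unitmxE det_scalar unitrX // unitfE natr_eq0 // -lt0n.
apply: leq_trans (eq_leq (esym rk_n)) _.
rewrite -[_%:M](subrK (const_mx 1)) -incidence_mulmx_tr.
apply: leq_trans (mxrank_add _ _) _; rewrite addnC leq_add //.
  exact: rank_const_mx_le1.
exact: mxrankM_maxl.
Qed.

Lemma incidence_tr_incidence : D *m D^T *m D = n%:R *: D.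
Proof.
by rewrite incidence_mulmx_tr mulmxBl const_mulmx_incidence subr0 mul_scalar_mx.
Qed.

End IncidenceMatrix.

(** * The inversion matrix over a field of characteristic zero *)

(** Precomposing with the transposition of [a] and [b] negates the sum, and 2 is invertible. *)
Lemma sum_perm_skew (F : fieldType) n (G : 'I_n -> 'I_n -> F) (a b : 'I_n) :
    [pchar F] =i pred0 -> (forall i j, G j i = - G i j) ->
  \sum_(t : {perm 'I_n}) G (t a) (t b) = 0.
Proof.
move=> F0 skewG; set N := \sum_t _.
have : N = - N.
  rewrite {1}/N -(sum_perm_lmul (tperm a b) (fun t => G (t a) (t b))) -sumrN.
  by apply: eq_bigr => t _; rewrite !permM tpermL tpermR skewG.
move/eqP; rewrite -addr_eq0 -mulr2n -mulr_natl mulf_eq0 natr_eq0 //=.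
by move/eqP.
Qed.

Section InversionMatrix.
Variables (F : fieldType) (n : nat) (X : ipair n -> F).
Hypotheses (F0 : [pchar F] =i pred0) (n4 : (4 <= n)%N).
Variables (e : 'I_(n`!) -> {perm 'I_n}) (he : bijective e).

Let S := \sum_p X p.
Let Sd := \sum_p (hi p - lo p)%:R * X p.
Local Notation K := #|{: ipair n}|.
Local Notation N := (n`!).

Let two_neq0 : 2%:R != 0 :> F. Proof. by rewrite natr_eq0. Qed.

(** Relabelling positions by [tau] turns the inversion condition into a comparison of [pi i] and
    [pi j], whose indicator is (1 + sgn) / 2 off the diagonal. *)
Lemma sum_INV (pi tau : {perm 'I_n}) :
  2%:R * \sum_(p in INV (tau^-1 * pi)%g) X p
  = S + \sum_p sgn F (pi (lo p)) (pi (hi p)) * skew X (tau (lo p)) (tau (hi p)).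
Proof.
pose u i j := upper X (tau i) (tau j).
have reindex_tau (G : 'I_n -> 'I_n -> F) :
    \sum_i \sum_j G i j = \sum_i \sum_j G (tau i) (tau j).
  rewrite (reindex_inj (@perm_inj _ tau)); apply: eq_bigr => i _.
  by rewrite (reindex_inj (@perm_inj _ tau)).
have -> : \sum_(p in INV (tau^-1 * pi)%g) X p
    = \sum_i \sum_j u i j * (pi j < pi i)%:R.
  pose s := (tau^-1 * pi)%g.
  transitivity (\sum_p X p * (s (hi p) < s (lo p))%:R).
    rewrite big_mkcond; apply: eq_bigr => p _.
    by rewrite inE; case: ltnP; rewrite ?mulr1 ?mulr0.
  rewrite -(sum_upper X (fun i j => (s j < s i)%:R)) reindex_tau.
  by apply: eq_bigr => i _; apply: eq_bigr => j _; rewrite !permM !permK.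
have -> : S = \sum_i \sum_j u i j.
  rewrite -(reindex_tau (upper X)) /S.
  transitivity (\sum_p X p * 1); first by apply: eq_bigr => p _; rewrite mulr1.
  rewrite -(sum_upper X (fun _ _ => 1)).
  by apply: eq_bigr => i _; apply: eq_bigr => j _; rewrite mulr1.
pose g i j := sgn F (pi i) (pi j).
have -> : \sum_p sgn F (pi (lo p)) (pi (hi p)) * skew X (tau (lo p)) (tau (hi p))
    = \sum_i \sum_j u i j * g i j.
  (* A product of two antisymmetric functions is symmetric, so twice the sum over pairs runs over
     all ordered pairs; there both halves of [skew] contribute equally. *)
  apply: (mulfI two_neq0).
  rewrite -(sum_ipair_sym (G := fun i j => g i j * skew X (tau i) (tau j))).
  - rewrite mulr_natl mulr2n [X in _ = _ + X]exchange_big /= -big_split /=.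
    apply: eq_bigr => i _; rewrite -big_split /=; apply: eq_bigr => j _.
    by rewrite /g (sgnC F (pi i)) /skew /u; ring.
  - by move=> i j; rewrite /g sgnC skewC mulrNN.
  - by move=> i; rewrite skewii mulr0.
rewrite mulr_sumr -big_split /=; apply: eq_bigr => i _.
rewrite mulr_sumr -big_split /=; apply: eq_bigr => j _.
rewrite /g /sgn /u; case: (ltngtP (pi i) (pi j)) => [_|_|/val_inj/perm_inj->].
- by rewrite /= ?mulr1n ?mulr0n; ring.
- by rewrite /= ?mulr1n ?mulr0n; ring.
- by rewrite upper_ge // !mul0r mulr0 addr0.
Qed.

(** [sgn_mx] and [skew_mx] are U and V of the overview. *)
Definition sgn_mx : 'M[F]_(N, K) :=
  \matrix_(x, p) sgn F (e x (lo (enum_val p))) (e x (hi (enum_val p))).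
Definition skew_mx : 'M[F]_(K, N) :=
  \matrix_(p, y) skew X (e y (lo (enum_val p))) (e y (hi (enum_val p))).
Definition inv_mx : 'M[F]_N :=
  \matrix_(x, y) \sum_(p in INV ((e y)^-1 * e x)%g) X p.

Lemma inv_mxE :
  2%:R *: inv_mx = const_mx S + sgn_mx *m skew_mx.
Proof.
apply/matrixP => x y; rewrite !mxE sum_INV; congr (_ + _).
rewrite (reindex_onto enum_val enum_rank) => [|p _]; last exact: enum_rankK.
by apply: eq_big => [p | p _]; rewrite ?enum_valK ?eqxx // !mxE.
Qed.

Lemma sum_enum_perm (f : {perm 'I_n} -> F) : \sum_x f (e x) = \sum_t f t.
Proof. by rewrite [RHS](reindex e) //; apply: onW_bij. Qed.

Lemma const_mulmx_sgn m c : const_mx c *m sgn_mx = 0 :> 'M_(m, _).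
Proof.
apply/matrixP => i p; rewrite !mxE.
under eq_bigr do rewrite !mxE.
rewrite -mulr_sumr (sum_enum_perm (fun t => sgn F (t _) (t _))).
rewrite sum_perm_skew ?mulr0 // => k l; exact: sgnC.
Qed.

Lemma skew_mulmx_const m c : skew_mx *m const_mx c = 0 :> 'M_(_, m).
Proof.
apply/matrixP => p i; rewrite !mxE.
under eq_bigr do rewrite !mxE.
rewrite -mulr_suml (sum_enum_perm (fun t => skew X (t _) (t _))).
rewrite sum_perm_skew ?mul0r // => k l; exact: skewC.
Qed.

Local Notation D := (incidence_mx F n).

Lemma skew_mulmx_sgn :
  skew_mx *m sgn_mx = 2%:R *: ((eig3 X)%:M + corr_coef X *: (D^T *m D)).
Proof.
apply/matrixP => p q; rewrite !mxE.
under eq_bigr do rewrite !mxE.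
set P := enum_val p; set Q := enum_val q.
have lP : (lo P < hi P)%N := valP P.
have lQ : (lo Q < hi Q)%N := valP Q.
rewrite (sum_enum_perm (fun t => skew X (t (lo P)) (t (hi P)) *
   sgn F (t (lo Q)) (t (hi Q)))).
rewrite -/(corr X (lo P) (hi P) (lo Q) (hi Q)) corrE //; last 2 first.
- by rewrite -val_eqE /= neq_ltn lP.
- by rewrite -val_eqE /= neq_ltn lQ.
congr (_ * (_ + _ * _)).
  rewrite -[_ *+ (p == q)]mulr_natr; congr (_ * _).
  (* Both pairs are increasing, so they cannot coincide crosswise. *)
  have -> : (lo P == hi Q) && (hi P == lo Q) = false.
    by apply/negP => /andP[/eqP PQ /eqP QP]; move: lP; rewrite PQ QP; lia.
  rewrite subr0; congr (_%:R); rewrite -(inj_eq enum_val_inj) -/P -/Q.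
  by rewrite -[P == Q]val_eqE /lo /hi; case: (val P) (val Q) => [a b] [c d].
under eq_bigr do rewrite !mxE -/P -/Q.
transitivity (\sum_v ((lo P == v)%:R * (lo Q == v)%:R - (lo P == v)%:R * (hi Q == v)%:R
   - (hi P == v)%:R * (lo Q == v)%:R + (hi P == v)%:R * (hi Q == v)%:R) : F).
  by rewrite big_split !sumrB /= !sum_delta2.
by apply: eq_bigr => v _; ring.
Qed.

Definition eig1 : F := N%:R / 2%:R * S.
Definition eig2 : F := - (n - 2)`!%:R * Sd.

(** Identifies a2 as a3 + n t, the form in which it arises from D^T D. *)
Lemma eig2E : eig2 = eig3 X + n%:R * corr_coef X.
Proof.
have -> : (eig2 = - ((n - 2) * (n - 3)`!)%:R * Sd).
  by rewrite /eig2 (_ : n - 2 = (n - 3).+1)%N //; lia.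
by rewrite natrM natrB ?(leq_trans _ n4) // /eig3 /corr_coef -/S -/Sd; ring.
Qed.

Lemma inv_mx_eigen1 : (1 <= \rank (eigenspace inv_mx eig1))%N.
Proof.
pose v : 'rV[F]_N := const_mx 1.
have : (v <= eigenspace inv_mx eig1)%MS.
  apply/eigenspaceP; apply: (scalerI two_neq0).
  rewrite scalemxAr inv_mxE mulmxDr mulmxA const_mulmx_sgn mul0mx addr0.
  apply/rowP => j; rewrite !mxE.
  under eq_bigr do rewrite !mxE mul1r.
  by rewrite sumr_const card_ord /eig1 mulr1 mulrA mulrCA mulfV // mulr1 mulr_natl.
by move/mxrankS; apply: leq_trans; rewrite rank_const_mx1_gt0 ?fact_gt0.
Qed.

(** Left eigenvectors [phi] of V U are carried to [phi *m skew_mx], eigenvectors of U V, on which J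
    acts as zero. No rank is lost, since multiplying further by U gives a nonzero multiple of
    [phi]. *)
Lemma inv_mx_eigen (m : nat) (phi : 'M[F]_(m, K)) a :
  a != 0 -> phi *m (skew_mx *m sgn_mx) = (2%:R * a) *: phi ->
  (\rank phi <= \rank (eigenspace inv_mx a))%N.
Proof.
move=> a0 phiW.
have le_phi : (\rank phi <= \rank (phi *m skew_mx))%N.
  have a20 : 2%:R * a != 0 by rewrite mulf_neq0.
  by rewrite -(mxrank_scale_nz phi a20) -phiW mulmxA mxrankM_maxl.
apply: leq_trans le_phi (mxrankS _); apply/eigenspaceP.
apply: (scalerI two_neq0); rewrite scalemxAr inv_mxE mulmxDr.
rewrite -[_ *m const_mx _]mulmxA skew_mulmx_const mulmx0 add0r.
by rewrite mulmxA -[_ *m sgn_mx]mulmxA phiW -scalemxAl scalerA.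
Qed.

Lemma inv_mx_eigen2 :
  eig2 != 0 -> (n - 1 <= \rank (eigenspace inv_mx eig2))%N.
Proof.
move=> a0; rewrite -(rank_incidence F0) ?(leq_trans _ n4) //; apply: inv_mx_eigen => //.
rewrite skew_mulmx_sgn -scalemxAr mulmxDr mul_mx_scalar -scalemxAr mulmxA.
by rewrite incidence_tr_incidence // !scalerA -scalerDl eig2E [_ * n%:R]mulrC scalerA.
Qed.

Lemma inv_mx_eigen3 : eig3 X != 0 ->
  ('C(n - 1, 2) <= \rank (eigenspace inv_mx (eig3 X)))%N.
Proof.
move=> a0; apply: leq_trans _ (inv_mx_eigen (phi := kermx D^T) a0 _); last first.
  rewrite skew_mulmx_sgn -scalemxAr mulmxDr mul_mx_scalar -scalemxAr mulmxA.
  by rewrite mulmx_ker mul0mx scaler0 addr0 scalerA.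
(* The kernel has dimension C(n, 2) - (n - 1), which is C(n - 1, 2) by Pascal's rule. *)
rewrite mxrank_ker mxrank_tr rank_incidence ?(leq_trans _ n4) // card_ipair.
by case: (n) n4 => // k _; rewrite subn1 binS bin1 addnK.
Qed.

(** The rank is at most 1 from J plus C(n, 2), the inner dimension of U V. *)
Lemma inv_mx_eigen0 : (N - 'C(n, 2) - 1 <= \rank (eigenspace inv_mx 0))%N.
Proof.
rewrite /eigenspace raddf0 subr0 mxrank_ker -subnDA leq_sub2l //.
rewrite -(mxrank_scale_nz inv_mx two_neq0) inv_mxE.
apply: leq_trans (mxrank_add _ _) _; rewrite addnC leq_add //.
  by rewrite -card_ipair (leq_trans (mxrankM_maxl _ _)) ?rank_leq_col.
exact: rank_const_mx_le1.
Qed.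

End InversionMatrix.

(** * The spectrum when the four values are distinct *)

Lemma inv_mx_spectrum (F : fieldType) n (X : ipair n -> F)
    (e : 'I_(n`!) -> {perm 'I_n}) (A := inv_mx X e)
    (a := [tuple eig1 X; eig2 X; eig3 X; 0]) :
    [pchar F] =i pred0 -> (4 <= n)%N -> bijective e -> uniq a ->
  [/\ diagonalizable A,
      (forall x, eigenvalue A x <-> x \in a)
    & [/\ eigen_mult A (eig1 X) = 1%N,
          eigen_mult A (eig2 X) = (n - 1)%N,
          eigen_mult A (eig3 X) = 'C(n - 1, 2)
        & eigen_mult A 0 = (n`! - 'C(n, 2) - 1)%N]].
Proof.
move=> F0 n4 he a_uniq.
pose m := [tuple 1%N; (n - 1)%N; 'C(n - 1, 2); (n`! - 'C(n, 2) - 1)%N].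
(* Distinctness from the last entry 0 supplies the nonvanishing that transferring eigenvectors from
   V U requires. *)
have [a20 a30] : eig2 X != 0 /\ eig3 X != 0.
  by move: a_uniq; rewrite /= !inE !negb_or; case/and4P => _ /andP[_ ?] ? _.
have bin_n : ('C(n, 2) = 'C(n - 1, 2) + (n - 1))%N.
  by case: (n) n4 => // k _; rewrite subn1 binS bin1.
have lt_fact := bin2S_lt_fact n4.
have bin_gt0 : (0 < 'C(n - 1, 2))%N by rewrite bin_gt0; lia.
have a_inj : injective (tnth a) by apply/tuple_uniqP.
have le_m i : (tnth m i <= \rank (eigenspace A (tnth a i)))%N.
  case: i => [[|[|[|[|//]]]] i4]; rewrite !(tnth_nth 0) /=.
  - exact: inv_mx_eigen1.
  - exact: inv_mx_eigen2.
  - exact: inv_mx_eigen3.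
  - exact: inv_mx_eigen0.
have sum_m : (\sum_i tnth m i = n`!)%N.
  by rewrite -(big_tuple _ _ m xpredT id) /= !big_cons big_nil; lia.
have [dA eigA multA] := spectrum_of_rank_eigenspace a_inj le_m sum_m.
(* Positive lower bounds show that each listed value really is an eigenvalue. *)
have /all_tnthP m_gt0 : all (fun k => 0 < k)%N m by rewrite /=; lia.
split=> //.
  move=> x; split=> [/eigA[i ->] | /tnthP[i ->]]; first exact: mem_tnth.
  rewrite /eigenvalue -mxrank_eq0 -lt0n.
  exact: leq_trans (m_gt0 i) (le_m i).
split.
- exact: (multA (Ordinal (isT : (0 < 4)%N))).
- exact: (multA (Ordinal (isT : (1 < 4)%N))).
- exact: (multA (Ordinal (isT : (2 < 4)%N))).
- exact: (multA (Ordinal (isT : (3 < 4)%N))).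
Qed.

(** * Passage to the fraction field and distinctness of the eigenvalues *)

Lemma uniq4 (T : eqType) (a b c d : T) :
    [/\ a != b, a != c & a != d] -> b != c -> b != d -> c != d ->
  uniq [:: a; b; c; d].
Proof. by move=> [ab ac ad] bc bd cd; rewrite /= !inE !negb_or ab ac ad bc bd cd. Qed.

Theorem theorem2 (R : realType) (n : nat) (hn : (4 <= n)%N)
    (e : 'I_(n`!) -> {perm 'I_n}) (he : bijective e) :
  let A := fracmx (inversion_mx R e) in
  let a1 := tofrac ((n`!%:R / 2%:R) *: \sum_(p : ipair n) Xvar R p) in
  let a2 := tofrac
    (- ((n - 2)`!%:R *: \sum_(p : ipair n) (hi p - lo p)%:R *: Xvar R p)) in
  let a3 := tofrac
    (- ((n - 3)`!%:R *:
        \sum_(p : ipair n) (n%:R - 2%:R * (hi p - lo p)%:R) *: Xvar R p)) in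
  [/\ diagonalizable A,
      (forall a, eigenvalue A a <-> a \in [:: a1; a2; a3; 0])
    & [/\ eigen_mult A a1 = 1%N,
          eigen_mult A a2 = (n - 1)%N,
          eigen_mult A a3 = 'C(n - 1, 2)
        & eigen_mult A 0 = (n`! - 'C(n, 2) - 1)%N]].
Proof.
move=> A a1 a2 a3.
pose X (p : ipair n) : {fraction (pairpoly R n)} := tofrac (Xvar R p).
have scale_nat k (q : pairpoly R n) : tofrac ((k%:R : R) *: q) = k%:R * tofrac q.
  by rewrite scaler_nat rmorphMn mulr_natl.
have F0 : [pchar {fraction (pairpoly R n)}] =i pred0.
  apply/pcharf0P => k.
  rewrite -(rmorph_nat (@tofrac (pairpoly R n))) tofrac_eq0.
  by rewrite -(rmorph_nat (@mpolyC _ R)) mpolyC_eq0 pnatr_eq0.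
have AE : A = inv_mx X e.
  by apply/matrixP => x y; rewrite !mxE rmorph_sum.
have a1E : a1 = eig1 X.
  apply: (mulfI (_ : 2%:R != 0)); first by rewrite natr_eq0.
  rewrite -scale_nat scalerA mulrCA mulfV ?pnatr_eq0 // mulr1 scale_nat rmorph_sum.
  by rewrite /eig1 mulrA mulrCA mulfV ?mulr1 // natr_eq0.
have a2E : a2 = eig2 X.
  rewrite /a2 rmorphN /eig2 mulNr; congr (- _).
  apply: etrans (scale_nat _ _) _; rewrite rmorph_sum; congr (_ * _).
  by apply: eq_bigr => p _; apply: scale_nat.
have a3E : a3 = eig3 X.
  rewrite /a3 rmorphN /eig3 mulNr; congr (- _).
  apply: etrans (scale_nat _ _) _; rewrite rmorph_sum; congr (_ * _).
  rewrite !mulr_sumr -sumrB; apply: eq_bigr => p _.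
  rewrite scalerBl -natrM rmorphB mulrA -natrM.
  by congr (_ - _); apply: scale_nat.
rewrite AE a1E a2E a3E; apply: inv_mx_spectrum => //.
rewrite -a1E -a2E -a3E.
(* All four values are linear forms, so one differing coefficient separates two of them. *)
pose P (c : ipair n -> R) : pairpoly R n := \sum_p c p *: Xvar R p.
have coefP c p : (P c)@_(U_(enum_rank p))%MM = c p.
  rewrite raddf_sum (bigD1 p) //= mcoeffZ mcoeffXU eqxx mulr1.
  rewrite big1 ?addr0 // => p' pp'.
  by rewrite mcoeffZ mcoeffXU (inj_eq enum_rank_inj) (negPf pp') mulr0.
have neqP c1 c2 p : c1 p != c2 p -> tofrac (P c1) != tofrac (P c2).
  by rewrite tofrac_eq; apply: contraNneq => c12; rewrite -!coefP c12.
have -> : a1 = tofrac (P (fun=> n`!%:R / 2%:R)) by rewrite /a1 scaler_sumr.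
have -> : a2 = tofrac (P (fun p => - ((n - 2)`!%:R * (hi p - lo p)%:R))).
  rewrite /a2 scaler_sumr -sumrN; congr tofrac.
  by apply: eq_bigr => p _; rewrite scalerA scaleNr.
have -> : a3 = tofrac
    (P (fun p => - ((n - 3)`!%:R * (n%:R - 2%:R * (hi p - lo p)%:R)))).
  rewrite /a3 scaler_sumr -sumrN; congr tofrac.
  by apply: eq_bigr => p _; rewrite scalerA scaleNr.
have -> : 0 = tofrac (P (fun=> 0)).
  by rewrite /P big1 ?tofrac0 // => p _; rewrite scale0r.
case: n hn {e he A a1 a2 a3 X scale_nat F0 AE a1E a2E a3E coefP} P neqP
  => [|[|[|[|k]]]] // _ P neqP.
(* At [p1], where j - i = 1, the coefficients of a1, a2, a3 and 0 are n!/2, -(n-2)!, -(n-2)! and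
   0. *)
pose p1 : ipair k.+4 :=
  exist _ (Ordinal (isT : 0 < k.+4), Ordinal (isT : 1 < k.+4))%N isT.
(* The coefficients of a2 and a3 agree at p1, so these two are separated at p2. *)
pose p2 : ipair k.+4 :=
  exist _ (Ordinal (isT : 0 < k.+4), Ordinal (isT : 2 < k.+4))%N isT.
have fact_gt k' : 0 < k'`!%:R :> R by rewrite ltr0n fact_gt0.
have k_ge0 : 0 <= k%:R :> R by rewrite ler0n.
have fact2 : (k.+4 - 2)`!%:R = (k%:R + 2%:R) * (k.+4 - 3)`!%:R :> R.
  by rewrite !subSS !subn0 factS natrM -natrD addn2.
have k4 : k.+4%:R = k%:R + 4%:R :> R by rewrite -natrD addn4.
have := fact_gt k.+4; have := fact_gt (k.+4 - 3)%N.
rewrite fact2 k4.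
(* With n = x + 4, what remains is real arithmetic in x >= 0 and the positive numbers (n-3)! and
   n!. *)
move: (k%:R : R) k_ge0 (k.+4`!%:R : R) ((k.+4 - 3)`!%:R : R) {fact2 k4}.
move=> x x_ge0 f4 f3 f3_gt0 f4_gt0.
have d1 : (hi p1 - lo p1)%:R = 1 :> R by [].
have d2 : (hi p2 - lo p2)%:R = 2%:R :> R by [].
apply: uniq4; [split | | |].
- by apply: (neqP _ _ p1); rewrite d1; apply/eqP; nra.
- by apply: (neqP _ _ p1); rewrite d1; apply/eqP; nra.
- by apply: (neqP _ _ p1); apply/eqP; nra.
- by apply: (neqP _ _ p2); rewrite d2; apply/eqP; nra.
- by apply: (neqP _ _ p1); rewrite d1; apply/eqP; nra.
- by apply: (neqP _ _ p1); rewrite d1; apply/eqP; nra.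
Qed.
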